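(* For every constant $C>0$ there is a constant $C'>0$, depending only on $C$, such that the following holds. Let $\mu=\sum_{i=1}^n\alpha_i\delta_{x_i}+\mu_c$ be a Borel probability measure on $\mathbb{S}^1$, where $n\ge1$, the points $x_1,\dots,x_n\in\mathbb{S}^1$ are distinct, $\alpha_i>0$, and $\mu_c$ is a measure with $\mu_c(\{x\})=0$ for all $x\in\mathbb{S}^1$ and $0<\mu_c(\mathbb{S}^1)<1$. Let $\delta>0$ and suppose that $$\mathbb{P}_\mu(\ell<1)\ge\frac13-C\delta^2.$$ Then $$\sum_{p\in\mathbb{S}^1:\ \mu(\{p\})\ne0}\mu(\{p\})^2\le C'\delta^2.$$ As a consequence, $\mu(\{p\})\le\sqrt{C'}\,\delta$ for every $p\in\mathbb{S}^1$.
   Context: $\mathbb{S}^1\subset\mathbb{R}^2$ is the unit circle centered at the origin. For $x,y\in\mathbb{S}^1$ with $x\ne y$, $\operatorname{aff}(x,y)$ is the line through $x$ and $y$; $\operatorname{aff}(x,x)$ is the tangent line to $\mathbb{S}^1$ at $x$. Define $f:(\mathbb{S}^1)^4\to[0,\infty]$ by: $f(x_1,x_2,x_3,x_4)=\|x_0\|_2$ if $\operatorname{aff}(x_1,x_2)\cap\operatorname{aff}(x_3,x_4)=\{x_0\}$ is a single point; $f(x_1,x_2,x_3,x_4)=$ the Euclidean distance from the line $\operatorname{aff}(x_1,x_2)$ to the origin if $\operatorname{aff}(x_1,x_2)=\operatorname{aff}(x_3,x_4)$; $f(x_1,x_2,x_3,x_4)=\infty$ if $\operatorname{aff}(x_1,x_2)\cap\operatorname{aff}(x_3,x_4)=\emptyset$.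 For a Borel probability measure $\mu$ on $\mathbb{S}^1$, $\mathbb{P}_\mu(\ell<r):=\mu^{\otimes 4}(\{f<r\})$, i.e. $\ell=f(X_1,X_2,X_3,X_4)$ with $X_i$ independent and $\mu$-distributed. *)

(* Defs.v *)
From HB Require Import structures.
From mathcomp Require Import all_boot all_order all_algebra.
From mathcomp Require Import all_classical all_reals all_analysis.

Set Implicit Arguments.
Unset Strict Implicit.
Unset Printing Implicit Defensive.

Import Order.TTheory GRing.Theory Num.Theory.
Import numFieldNormedType.Exports.

Local Open Scope classical_set_scope.
Local Open Scope ring_scope.

(* The library norm on [R * R] is the sup norm, hence these Euclidean
   versions. *)
Definition dot (R : realType) (p q : R * R) : R := p.1 * q.1 + p.2 * q.2.

Definition enorm (R : realType) (p : R * R) : R := Num.sqrt (dot p p).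

Definition unit_circle (R : realType) : set (R * R)%type := [set p | enorm p = 1].

Arguments unit_circle : clear implicits.

Definition circle (R : realType) : Type := set_type (unit_circle R).

Lemma unit_circle_pt (R : realType) : ((1, 0) : R * R) \in unit_circle R.
Proof.
by apply/mem_set; rewrite /unit_circle/= /enorm /dot /= mulr1 mulr0 addr0 sqrtr1.
Qed.

(* [circle R] carries the subspace topology of the plane and its Borel
   sigma-algebra. Measurable types must be pointed; the base point (1, 0)
   plays no other role. *)
HB.instance Definition _ (R : realType) :=
  Topological.copy (circle R) (set_type (unit_circle R)).
HB.instance Definition _ (R : realType) :=
  isPointed.Build (circle R) (exist _ (1, 0) (unit_circle_pt R)).
HB.instance Definition _ (R : realType) :=
  Measurable.copy (circle R) (g_sigma_algebraType (@open (circle R))).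

Definition pt (R : realType) (x : circle R) : R * R := set_val x.

Definition aff (R : realType) (x y : circle R) : set (R * R)%type :=
  if x == y then [set p | dot (p - pt x) (pt x) = 0]
  else [set p | exists t : R, p = pt x + t *: (pt y - pt x)].

Definition dist_origin (R : realType) (L : set (R * R)%type) : R :=
  inf [set enorm p | p in L].

(* The last branch is the case of an empty intersection, since two distinct
   lines never share more than one point. *)
Definition ell (R : realType) (x1 x2 x3 x4 : circle R) : \bar R :=
  let L := aff x1 x2 in
  let L' := aff x3 x4 in
  if `[< exists x0, L `&` L' = [set x0] >] then (enorm (get (L `&` L')))%:E
  else if `[< L = L' >] then (dist_origin L)%:E
  else +oo%E.

Definition prob_ell_lt (R : realType) (mu : probability (circle R) R) (r : R) :
    \bar R :=
  (mu \x mu \x mu \x mu)%E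
    [set z : circle R * circle R * circle R * circle R |
      (ell z.1.1.1 z.1.1.2 z.1.2 z.2 < r%:E)%E].

(* Main.v *)
(** Four distinct points on the circle can be paired up in three ways, and the
    chords of at most one of these pairings cross inside the disc. So the three
    events [ell < 1] obtained by permuting four independent samples, which are
    equiprobable, essentially exclude each other; their only overlaps, as well
    as the only loss, come from coincidences among the samples. Writing S_k for
    the sum of the k-th powers of the atoms, this gives
      3 P(ell < 1) <= 1 - 6 S_2 + 9 S_2^2 + 8 S_3 - 12 S_4,
    and an elementary estimate shows that the right-hand side is at most
    1 - S_2 / 6. *)
Require Import Defs.
From HB Require Import structures.
From mathcomp Require Import all_boot all_order all_algebra ring lra zify.
From mathcomp Require Import all_classical all_reals all_analysis measurable_realfun.
Import Order.TTheory GRing.Theory Num.Theory.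
Import numFieldNormedType.Exports.
Local Open Scope classical_set_scope.
Local Open Scope ring_scope.

(** * Chords, oriented areas and the event that the two lines meet inside the disc *)

Section chords.
Context (R : realType).
Implicit Types (p q r : R * R) (a b c d : circle R).

(** Twice the oriented area of the triangle [p q r]; its sign tells on which side of the line [p q]
    the point [r] lies. *)
Definition area p q r : R :=
  (q.1 - p.1) * (r.2 - p.2) - (q.2 - p.2) * (r.1 - p.1).

Definition chords_cross a b c d : bool :=
  (area (pt a) (pt b) (pt c) * area (pt a) (pt b) (pt d) < 0) &&
  (area (pt c) (pt d) (pt a) * area (pt c) (pt d) (pt b) < 0).

(** This covers coinciding lines. The condition [a != b] discards tangents, whose distance to the
    origin is 1 and not smaller. *)
Definition same_chord a b c d : bool :=
  (a != b) && (((a == c) && (b == d)) || ((a == d) && (b == c))).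

Definition chords_meet a b c d : bool :=
  chords_cross a b c d || same_chord a b c d.

Lemma pt_inj : injective (@pt R).
Proof. exact: val_inj. Qed.

Lemma dot_ge0 p : 0 <= dot p p.
Proof. by rewrite /dot addr_ge0// -expr2 sqr_ge0. Qed.

Lemma dot_pt a : dot (pt a) (pt a) = 1.
Proof.
have : enorm (pt a) = 1 by exact: (set_mem (valP a)).
by rewrite /enorm => h; rewrite -(sqr_sqrtr (dot_ge0 (pt a))) h expr1n.
Qed.

Lemma enorm_lt1 p : (enorm p < 1) = (dot p p < 1).
Proof. by rewrite /enorm -[X in _ < X]sqrtr1 ltr_sqrt. Qed.

Lemma dist_pt_gt0 a b : a != b -> 0 < dot (pt b - pt a) (pt b - pt a).
Proof.
move=> ab; rewrite lt_neqAle dot_ge0 andbT; apply: contra ab => /eqP/esym.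
rewrite /dot /= => /eqP; rewrite -!expr2 paddr_eq0 ?sqr_ge0// !sqrf_eq0 !subr_eq0.
move=> /andP[/eqP h1 /eqP h2]; apply/eqP/pt_inj; symmetry.
by rewrite [pt b]surjective_pairing h1 h2 -surjective_pairing.
Qed.

(** This is the power of the point [p] with respect to the circle, computed along the secant through
    [a] and [b]. *)
Lemma dot_chord a b p (t : R) : p = pt a + t *: (pt b - pt a) ->
  dot p p = 1 - t * (1 - t) * dot (pt b - pt a) (pt b - pt a).
Proof.
move=> ->; have := dot_pt a; have := dot_pt b; rewrite /dot /=.
move: (pt a).1 (pt a).2 (pt b).1 (pt b).2 => a1 a2 b1 b2 hb ha.
have -> : t *: (b1 - a1) = t * (b1 - a1) by [].
have -> : t *: (b2 - a2) = t * (b2 - a2) by [].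
transitivity ((1 - t) * (a1 * a1 + a2 * a2) + t * (b1 * b1 + b2 * b2) -
  t * (1 - t) * ((b1 - a1) * (b1 - a1) + (b2 - a2) * (b2 - a2))); first by ring.
by rewrite ha hb; ring.
Qed.

Lemma dot_chord_lt1 a b p (t : R) : p = pt a + t *: (pt b - pt a) ->
  a != b -> (dot p p < 1) = (0 < t < 1).
Proof.
move=> pE ab; rewrite (dot_chord _ _ _ _ pE) gtrBl pmulr_lgt0 ?dist_pt_gt0//.
apply/idP/idP; last by move=> /andP[t0 t1]; rewrite mulr_gt0// subr_gt0.
by move=> h; apply/andP; split; nra.
Qed.

Lemma area_chord a b p q (t : R) :
  area p q (pt a + t *: (pt b - pt a)) =
  (1 - t) * area p q (pt a) + t * area p q (pt b).
Proof.
rewrite /area /=.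
have -> : t *: ((pt b).1 - (pt a).1) = t * ((pt b).1 - (pt a).1) by [].
have -> : t *: ((pt b).2 - (pt a).2) = t * ((pt b).2 - (pt a).2) by [].
by ring.
Qed.

Lemma area_line a b p :
  a != b -> area (pt a) (pt b) p = 0 ->
  exists s, p = pt a + s *: (pt b - pt a).
Proof.
move=> /dist_pt_gt0 n0 A0.
(* The coefficient of the orthogonal projection of [p - a] onto [b - a]; the component normal to the
   chord is a multiple of the area, hence zero. *)
exists (dot (p - pt a) (pt b - pt a) / dot (pt b - pt a) (pt b - pt a)).
move: n0 A0; rewrite /area /dot /=.
case: p (pt a) (pt b) => [p1 p2] [a1 a2] [b1 b2] /= n0 A0.
set s := _ / _.
have e : s * ((b1 - a1) * (b1 - a1) + (b2 - a2) * (b2 - a2)) =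
  (p1 - a1) * (b1 - a1) + (p2 - a2) * (b2 - a2) by rewrite /s divfK// gt_eqF.
clearbody s; move: e n0.
move nE : ((b1 - a1) * (b1 - a1) + (b2 - a2) * (b2 - a2)) => n e n0.
have h1 : p1 = a1 + s * (b1 - a1).
  apply: (mulIf (lt0r_neq0 n0)).
  transitivity (a1 * n + (b1 - a1) * (s * n)); last by ring.
  rewrite e; apply/eqP; rewrite -subr_eq0; apply/eqP.
  transitivity (- (b2 - a2) * ((b1 - a1) * (p2 - a2) - (b2 - a2) * (p1 - a1))); first by rewrite -nE; ring.
  by rewrite A0 mulr0.
have h2 : p2 = a2 + s * (b2 - a2).
  apply: (mulIf (lt0r_neq0 n0)).
  transitivity (a2 * n + (b2 - a2) * (s * n)); last by ring.
  rewrite e; apply/eqP; rewrite -subr_eq0; apply/eqP.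
  transitivity ((b1 - a1) * ((b1 - a1) * (p2 - a2) - (b2 - a2) * (p1 - a1))); first by rewrite -nE; ring.
  by rewrite A0 mulr0.
by rewrite {1}h1 {1}h2.
Qed.

(** A line meets the circle at most twice: [c] has norm 1, so the power of the point forces
    [s * (1 - s) = 0]. *)
Lemma area_pt_eq0 a b c :
  a != b -> area (pt a) (pt b) (pt c) = 0 -> (c == a) || (c == b).
Proof.
move=> ab /(area_line _ _ _ ab)[s cE].
have := dot_chord _ _ _ _ cE; rewrite dot_pt => h.
have /eqP : s * (1 - s) * dot (pt b - pt a) (pt b - pt a) = 0 by lra.
rewrite mulf_eq0 (gt_eqF (dist_pt_gt0 _ _ ab)) orbF mulf_eq0 subr_eq0 => /orP[/eqP s0|/eqP s1].
  by apply/orP; left; apply/eqP/pt_inj; rewrite cE s0 scale0r addr0.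
by apply/orP; right; apply/eqP/pt_inj; rewrite cE -s1 scale1r addrC subrK.
Qed.

Lemma aff_lt1 a b p : aff a b p -> dot p p < 1 ->
  a != b /\ exists2 t : R, p = pt a + t *: (pt b - pt a) & 0 < t < 1.
Proof.
rewrite /aff; case: (eqVneq a b) => [_ /= tg|ab /= [t pE]] p1; last first.
  by split => //; exists t => //; rewrite -(dot_chord_lt1 _ _ _ _ pE).
(* On the tangent at [a], Pythagoras gives [dot p p = 1 + dot (p - a) (p - a)], so no point of it
   lies in the open disc. *)
exfalso; move: p1 tg; have := dot_pt a; rewrite /dot /=.
case: p (pt a) => [p1 p2] [a1 a2] /= ha p1' tg.
by have := sqr_ge0 (p1 - a1); have := sqr_ge0 (p2 - a2); rewrite !expr2; nra.
Qed.

Lemma area_collinear a b p (t : R) :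
  p = pt a + t *: (pt b - pt a) -> area (pt a) (pt b) p = 0.
Proof.
by move=> ->; rewrite area_chord /area; ring.
Qed.

Lemma mul_lt0_of_convex_comb0 (x y t : R) :
  0 < t < 1 -> (1 - t) * x + t * y = 0 -> x != 0 -> x * y < 0.
Proof.
move=> /andP[t0 t1] e x0.
have : 0 < x ^+ 2 by rewrite exprn_even_gt0.
have : t * (x * y) = - ((1 - t) * x ^+ 2).
  by transitivity (x * ((1 - t) * x + t * y) - (1 - t) * x ^+ 2); [ring | rewrite e; ring].
by move=> h x2; nra.
Qed.

(* A point common to both lines lies in both open chords by its norm; the
   degenerate case is that all four points are collinear. *)
Lemma meet_of_common_point a b c d p :
  aff a b p -> aff c d p -> dot p p < 1 -> chords_meet a b c d.
Proof.
move=> abp cdp p1.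
have [ab [t pt_ t01]] := aff_lt1 _ _ _ abp p1.
have [cd [s ps s01]] := aff_lt1 _ _ _ cdp p1.
have ecd : (1 - t) * area (pt c) (pt d) (pt a) + t * area (pt c) (pt d) (pt b) = 0.
  by rewrite -area_chord -pt_ (area_collinear _ _ _ _ ps).
have eab : (1 - s) * area (pt a) (pt b) (pt c) + s * area (pt a) (pt b) (pt d) = 0.
  by rewrite -area_chord -ps (area_collinear _ _ _ _ pt_).
rewrite /chords_meet /chords_cross /same_chord ab /=.
have [z|nz] := eqVneq (area (pt a) (pt b) (pt c)) 0; last first.
  have [z'|nz'] := eqVneq (area (pt c) (pt d) (pt a)) 0; last first.
    by rewrite (mul_lt0_of_convex_comb0 _ _ _ s01 eab nz)
               (mul_lt0_of_convex_comb0 _ _ _ t01 ecd nz').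
  have /orP[/eqP ac|/eqP ad] := area_pt_eq0 _ _ _ cd z'.
    by case/eqP: nz; rewrite ac /area; ring.
  have z2 : area (pt c) (pt d) (pt b) = 0.
    by move: ecd; rewrite z' mulr0 add0r => /eqP; rewrite mulf_eq0 gt_eqF ?(andP t01).1//= => /eqP.
  have /orP[/eqP bc|/eqP bd] := area_pt_eq0 _ _ _ cd z2.
    by rewrite ad bc !eqxx /= !orbT.
  by move: ab; rewrite ad bd eqxx.
have z2 : area (pt a) (pt b) (pt d) = 0.
  by move: eab; rewrite z mulr0 add0r => /eqP; rewrite mulf_eq0 gt_eqF ?(andP s01).1//= => /eqP.
apply/orP; right; rewrite (eq_sym a) (eq_sym b) (eq_sym a) (eq_sym b).
move: cd; have /orP[/eqP ->|/eqP ->] := area_pt_eq0 _ _ _ ab z;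
  have /orP[/eqP ->|/eqP ->] := area_pt_eq0 _ _ _ ab z2;
  by rewrite ?eqxx /= ?orbT.
Qed.

Lemma affC a b : aff a b = aff b a.
Proof.
rewrite /aff eq_sym; case: eqVneq => [->//|_].
have sub (u v : R * R) :
    [set p | exists t : R, p = u + t *: (v - u)] `<=`
    [set p | exists t : R, p = v + t *: (u - v)].
  move=> _ [t ->]; exists (1 - t).
  by rewrite [in RHS]scalerBl scale1r addrA [v + (u - v)]addrC subrK -scalerN opprB.
by apply/seteqP; split; exact: sub.
Qed.

Lemma aff_left a b : aff a b (pt a).
Proof.
rewrite /aff; case: ifP => _ /=.
  by rewrite /dot subrr /= !mul0r addr0.
by exists 0; rewrite scale0r addr0.
Qed.

Lemma dist_aff_lt1 a b : a != b -> dist_origin (aff a b) < 1.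
Proof.
move=> ab; set m := pt a + 2^-1 *: (pt b - pt a).
have m1 : enorm m < 1.
  by rewrite enorm_lt1 (dot_chord_lt1 a b m 2^-1)//; lra.
apply: le_lt_trans m1; apply: ge_inf.
  by exists 0 => _ [p _ <-]; exact: sqrtr_ge0.
by exists m => //; rewrite /aff (negbTE ab); exists 2^-1.
Qed.

Lemma ell_meet a b c d : chords_meet a b c d -> (ell a b c d < 1%:E)%E.
Proof.
case/orP => [/andP[ABCD CDAB]|/andP[ab sm]]; last first.
  have affE : aff a b = aff c d.
    by case/orP: sm => /andP[/eqP-> /eqP->]//; exact: affC.
  (* A line through two distinct points is not a singleton, so [ell] takes its value from the
     distance branch. *)
  rewrite /ell -affE setIid; case: ifPn => [/asboolP[x0 ax0]|_].
    have := aff_left b a; rewrite affC ax0 /= => eb.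
    have := aff_left a b; rewrite ax0 /= -eb => /pt_inj e.
    by rewrite e eqxx in ab.
  by rewrite asboolT// lte_fin dist_aff_lt1.
have ab : a != b.
  by apply: contraTN ABCD => /eqP ->; rewrite /area !subrr !mul0r subrr mul0r ltxx.
have cd : c != d.
  by apply: contraTN CDAB => /eqP ->; rewrite /area !subrr !mul0r subrr mul0r ltxx.
rewrite /ell.
(* Along the line [a b] the area relative to [c d] is affine in the parameter and has opposite signs
   at [a] and [b]. Its only zero [t] therefore lies strictly between 0 and 1 and gives the
   intersection point. *)
have sol (u : R) : area (pt c) (pt d) (pt a + u *: (pt b - pt a)) = 0 ->
    u = area (pt c) (pt d) (pt a) / (area (pt c) (pt d) (pt a) - area (pt c) (pt d) (pt b)).
  rewrite area_chord => h; apply: (canRL (mulfK _)); last by lra.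
  by apply: contraTN CDAB => /eqP h'; rewrite -leNgt; nra.
set t := area (pt c) (pt d) (pt a) / _ in sol.
have dn : area (pt c) (pt d) (pt a) - area (pt c) (pt d) (pt b) != 0.
  by apply: contraTN CDAB => /eqP h'; rewrite -leNgt; nra.
have tE : t * (area (pt c) (pt d) (pt a) - area (pt c) (pt d) (pt b)) = area (pt c) (pt d) (pt a).
  by rewrite /t divfK.
have t01 : 0 < t < 1.
  clearbody t; clear sol; move: CDAB dn tE.
  move: (area _ _ _) (area _ _ _) => A B AB dn tE.
  by apply/andP; split; nra.
pose p := pt a + t *: (pt b - pt a).
have p0 : area (pt c) (pt d) p = 0 by rewrite area_chord; lra.
have pE : aff a b `&` aff c d = [set p].
  rewrite /aff (negbTE ab) (negbTE cd); apply/seteqP; split => [q [] /= [u qu] [v qv]|_ -> /=].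
    by rewrite qu (sol u) // -qu (area_collinear _ _ _ _ qv).
  by split; [exists t | exact: area_line].
rewrite asboolT; last by exists p.
by rewrite pE (getI (erefl : [set p] p)) lte_fin enorm_lt1 (dot_chord_lt1 a b p t).
Qed.

(** This replaces the geometric event by a Boolean condition on signs and equalities, which serves
    both measurability and the counting of pairings. *)
Lemma ell_lt1 a b c d : (ell a b c d < 1%:E)%E = chords_meet a b c d.
Proof.
apply/idP/idP; last exact: ell_meet.
rewrite /ell; case: ifPn => [/asboolP[x0 e]|_].
  rewrite e (getI (erefl : [set x0] x0)) lte_fin enorm_lt1 => x1.
  have [h1 h2] : (aff a b `&` aff c d) x0 by rewrite e.
  exact: meet_of_common_point h1 h2 x1.
case: ifPn => [/asboolP e|_ //]; rewrite lte_fin => /inf_lt[].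
  (* An infimum below 1 over a nonempty set yields a point of the common line inside the open
     disc. *)
  by exists (enorm (pt a)), (pt a) => //; exact: aff_left.
move=> _ [p abp <-]; rewrite enorm_lt1; apply: meet_of_common_point => //.
by rewrite -e.
Qed.
End chords.

(** * The three pairings of four points and their coincidences *)

Lemma mulr_lt0_sign (R : realDomainType) (x y : R) : x * y < 0 ->
  (0 < x /\ y < 0) \/ (x < 0 /\ 0 < y).
Proof.
case: (ltrgt0P x) => [x0|x0|->]; rewrite ?mul0r ?ltxx//.
  by rewrite pmulr_rlt0// => y0; left.
by rewrite nmulr_rlt0// => y0; right.
Qed.

Section pairings.
Context (R : realType).
Implicit Types (a b c d : circle R).

Lemma chords_cross_neq a b c d : chords_cross R a b c d ->
  [&& a != b, a != c, a != d, b != c, b != d & c != d].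
Proof.
have z1 p q : area R p p q = 0 by rewrite /area; ring.
have z2 p q : area R p q p = 0 by rewrite /area; ring.
have z3 p q : area R p q q = 0 by rewrite /area; ring.
move=> /andP[h1 h2]; repeat (apply/andP; split);
  apply/negP => /eqP e; subst; move: h1 h2;
  by rewrite ?(z1, z2, z3) ?mul0r ?mulr0 ?ltxx.
Qed.

(* The four oriented areas satisfy abc - abd + acd - bcd = 0, which fails when
   two of the three sign patterns hold simultaneously. *)
Lemma chords_cross_exclusive a b c d :
  (chords_cross R a b c d + chords_cross R a c b d + chords_cross R a d b c <= 1)%N.
Proof.
rewrite /chords_cross.
have e1 p q r : area R p r q = - area R p q r by rewrite /area; ring.
have e2 p q r : area R q r p = area R p q r by rewrite /area; ring.
have : area R (pt a) (pt b) (pt c) - area R (pt a) (pt b) (pt d)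
  + area R (pt a) (pt c) (pt d) - area R (pt b) (pt c) (pt d) = 0.
  by rewrite /area; ring.
rewrite (e2 (pt a) (pt c) (pt d)) (e2 (pt b) (pt c) (pt d)) (e1 (pt a) (pt b) (pt c)).
rewrite (e2 (pt a) (pt b) (pt d)) (e1 (pt b) (pt c) (pt d)).
rewrite (e1 (pt a) (pt b) (pt d)) (e1 (pt a) (pt c) (pt d)).
rewrite (e2 (pt a) (pt b) (pt c)).
move: (area _ _ _ _) (area _ (pt a) (pt b) (pt d)) (area _ (pt a) (pt c) (pt d))
  (area _ _ _ _) => D X B A e.
(* Any two patterns make [A] and [B] share one strict sign and [X] and [D] the opposite one, so the
   alternating sum cannot vanish. *)
have n12 : A * X < 0 -> B * D < 0 -> - A * B < 0 -> X * - D < 0 -> False.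
  by move=> /mulr_lt0_sign[] [? ?] /mulr_lt0_sign[] [? ?] /mulr_lt0_sign[] [? ?] _; lra.
have n13 : A * X < 0 -> B * D < 0 -> - X * - B < 0 -> A * D < 0 -> False.
  by move=> /mulr_lt0_sign[] [? ?] /mulr_lt0_sign[] [? ?] /mulr_lt0_sign[] [? ?] _; lra.
have n23 : - A * B < 0 -> X * - D < 0 -> - X * - B < 0 -> A * D < 0 -> False.
  by move=> /mulr_lt0_sign[] [? ?] /mulr_lt0_sign[] [? ?] /mulr_lt0_sign[] [? ?] _; lra.
case: (boolP (_ && _)) => [/andP[h1 h2]|_]; case: (boolP (_ && _)) => [/andP[h3 h4]|_] //;
  case: (boolP (_ && _)) => [/andP[h5 h6]|_] //; exfalso; eauto.
Qed.

(* Integrated against mu^4 this is 3 P(l < 1) <= 1 - 6 S2 + 9 S2^2 + 8 S3 - 12 S4,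
   where S_k is the sum of the k-th powers of the atoms. *)
Lemma chords_meet_bound a b c d :
  (chords_meet R a b c d + chords_meet R a c b d + chords_meet R a d b c
   + ((a == b) + (a == c) + (a == d) + (b == c) + (b == d) + (c == d))
   + 12 * [&& a == b, b == c & c == d]
   <= 1 + 3 * (((a == b) && (c == d)) + ((a == c) && (b == d)) + ((a == d) && (b == c)))
      + 2 * (((a == b) && (b == c)) + ((a == b) && (b == d)) + ((a == c) && (c == d))
             + ((b == c) && (c == d))))%N.
Proof.
have := chords_cross_exclusive a b c d.
have := @chords_cross_neq a b c d; have := @chords_cross_neq a c b d.
have := @chords_cross_neq a d b c.
rewrite /chords_meet /same_chord.
(* With transitivity recorded for every triple, the claim becomes propositional in six equalities
   and three crossings and is checked on all truth values. *)
have tr (x y z : circle R) : [&& (x == y) && (y == z) ==> (x == z),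
    (x == y) && (x == z) ==> (y == z) & (x == z) && (y == z) ==> (x == y)].
  by apply/and3P; split; apply/implyP => /andP[/eqP e1 /eqP e2]; apply/eqP; congruence.
move: (tr a b c) (tr a b d) (tr a c d) (tr b c d).
rewrite ?(eq_sym b a, eq_sym c a, eq_sym d a, eq_sym c b, eq_sym d b, eq_sym d c).
move: (a == b) (a == c) (a == d) (b == c) (b == d) (c == d).
move: (chords_cross _ a b c d) (chords_cross _ a c b d) (chords_cross _ a d b c).
(* The weights make both sides equal in every pattern with a coincidence: 1 for one equal pair, 4
   for two disjoint pairs (two pairings then give the same chord twice), 3 for a triple, 18 for a
   quadruple. For four distinct points only the crossings count, and they add up to at most 1. *)
by do 3 case; do 6 case.
Qed.
End pairings.

(** * Measurability of coincidences and of meeting chords *)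

Section measurability.
Context (R : realType).

Lemma continuous_pt : continuous (@pt R).
Proof. exact: initial_continuous. Qed.

Lemma continuous_measurable_circle (f : circle R -> R) :
  continuous f -> measurable_fun setT f.
Proof.
move=> cf; apply: (measurability _ (RGenOpens.measurableE R)) => _ [_ [a [b ->] <-]].
rewrite setTI; apply: sub_sigma_algebra.
by move/continuousP: cf; apply; exact: interval_open.
Qed.

Lemma measurable_pt1 : measurable_fun setT (fun x : circle R => (pt x).1).
Proof.
apply: continuous_measurable_circle => x.
by apply: continuous_comp; [exact: continuous_pt | exact: cvg_fst].
Qed.

Lemma measurable_pt2 : measurable_fun setT (fun x : circle R => (pt x).2).
Proof.
apply: continuous_measurable_circle => x.
by apply: continuous_comp; [exact: continuous_pt | exact: cvg_snd].
Qed.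

Context d (U : measurableType d).
Implicit Types f g h k : U -> circle R.

Lemma measurable_circle_eq f g : measurable_fun setT f -> measurable_fun setT g ->
  measurable_fun setT (fun u => f u == g u).
Proof.
move=> mf mg.
have -> : (fun u => f u == g u) =
  (fun u => ((pt (f u)).1 == (pt (g u)).1) && ((pt (f u)).2 == (pt (g u)).2)).
  apply/funext => u; apply/eqP/andP => [->|[/eqP h1 /eqP h2]]; first by rewrite !eqxx.
  by apply: pt_inj; rewrite [pt _]surjective_pairing h1 h2 -surjective_pairing.
have m1 (p : circle R -> R) : measurable_fun setT p ->
    measurable_fun setT (fun u => p (f u) == p (g u)).
  by move=> mp; apply: measurable_fun_eqr; exact: measurableT_comp.
by apply: measurable_and; [apply: (m1 (fun x => (pt x).1)); exact: measurable_pt1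
                         | apply: (m1 (fun x => (pt x).2)); exact: measurable_pt2].
Qed.

Lemma measurable_area f g h : measurable_fun setT f -> measurable_fun setT g ->
  measurable_fun setT h ->
  measurable_fun setT (fun u => area R (pt (f u)) (pt (g u)) (pt (h u))).
Proof.
move=> mf mg mh.
have m1 (p : U -> circle R) : measurable_fun setT p -> measurable_fun setT (fun u : U => (pt (p u)).1).
  by move=> mp; apply: (measurableT_comp measurable_pt1).
have m2 (p : U -> circle R) : measurable_fun setT p -> measurable_fun setT (fun u : U => (pt (p u)).2).
  by move=> mp; apply: (measurableT_comp measurable_pt2).
by apply: measurable_funB; apply: measurable_funM; apply: measurable_funB; auto.
Qed.

Lemma measurable_chords_meet f g h k :
  measurable_fun setT f -> measurable_fun setT g ->
  measurable_fun setT h -> measurable_fun setT k ->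
  measurable_fun setT (fun u => chords_meet R (f u) (g u) (h u) (k u)).
Proof.
move=> mf mg mh mk; apply: measurable_or; apply: measurable_and.
- apply: measurable_fun_ltr; last exact: measurable_cst.
  by apply: measurable_funM; exact: measurable_area.
- apply: measurable_fun_ltr; last exact: measurable_cst.
  by apply: measurable_funM; exact: measurable_area.
- by apply: measurable_neg; exact: measurable_circle_eq.
- by apply: measurable_or; apply: measurable_and; exact: measurable_circle_eq.
Qed.

End measurability.

(** * Probabilities of events of four independent samples, and their invariance under swaps *)

Section four_samples.
Context (R : realType) (mu : probability (circle R) R).
Local Notation T := (circle R).
Local Notation quad := (T * T * T * T)%type.
Implicit Types g : T -> T -> T -> T -> bool.

Definition quad_set g : set quad := [set z | g z.1.1.1 z.1.1.2 z.1.2 z.2].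

Definition measurable4 g :=
  measurable_fun setT (fun z : quad => g z.1.1.1 z.1.1.2 z.1.2 z.2).

Definition integral4 (f : T -> T -> T -> T -> \bar R) : \bar R :=
  (\int[mu]_a \int[mu]_b \int[mu]_c \int[mu]_d f a b c d)%E.

Lemma measurable_coord1 : measurable_fun setT (fun z : quad => z.1.1.1).
Proof.
exact: (measurableT_comp measurable_fst (measurableT_comp measurable_fst measurable_fst)).
Qed.

Lemma measurable_coord2 : measurable_fun setT (fun z : quad => z.1.1.2).
Proof.
exact: (measurableT_comp measurable_snd (measurableT_comp measurable_fst measurable_fst)).
Qed.

Lemma measurable_coord3 : measurable_fun setT (fun z : quad => z.1.2).
Proof. exact: (measurableT_comp measurable_snd measurable_fst). Qed.

Lemma measurable_coord4 : measurable_fun setT (fun z : quad => z.2).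
Proof. exact: measurable_snd. Qed.

Let f4 g (z : quad) : \bar R := ((g z.1.1.1 z.1.1.2 z.1.2 z.2)%:R)%:E.

Lemma measurable_quad_set g : measurable4 g -> measurable (quad_set g).
Proof.
move=> mg; rewrite [quad_set g](_ : _ = [set: quad] `&`
  (fun z : quad => g z.1.1.1 z.1.1.2 z.1.2 z.2) @^-1` [set true]).
  exact: mg.
by rewrite setTI; apply/seteqP; split.
Qed.

Let f4E g : f4 g = EFin \o \1_(quad_set g).
Proof.
apply/funext => z; rewrite /f4 /= indicE; do 3 congr (_ _).
by apply/idP/idP => [h|/set_mem//]; first exact/mem_set.
Qed.

Let measurable_f4 g : measurable4 g -> measurable_fun setT (f4 g).
Proof.
move=> /measurable_quad_set mg; rewrite f4E; apply/measurable_EFinP.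
exact: measurable_indic.
Qed.

Let f4_ge0 g z : (0 <= f4 g z)%E.
Proof. by rewrite lee_fin. Qed.


Lemma fubini_F_ge0 d1 d2 (T1 : measurableType d1) (T2 : measurableType d2)
  (m2 : {measure set T2 -> \bar R}) (f : T1 * T2 -> \bar R) :
  (forall x, 0 <= f x)%E -> forall x, (0 <= fubini_F m2 f x)%E.
Proof. by move=> f0 x; apply: integral_ge0. Qed.

(** Naming the partial products fixes the left-nested association of the fourfold product, so that
    Tonelli can peel off one coordinate at a time. *)
Definition prob2 : probability (T * T)%type R := (mu \x mu)%E.
Definition prob3 : probability (T * T * T)%type R := (prob2 \x mu)%E.
Definition prob4 : probability quad R := (prob3 \x mu)%E.

Lemma integral_quad (f : quad -> \bar R) : measurable_fun setT f ->
  (forall z, 0 <= f z)%E ->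
  (\int[prob4]_z f z = integral4 (fun a b c d => f (a, b, c, d)))%E.
Proof.
move=> mf f0.
have m3 := measurable_fun_fubini_tonelli_F (m2 := mu) f mf f0.
have f3 := fubini_F_ge0 _ _ _ _ mu f f0.
have m2 := measurable_fun_fubini_tonelli_F (m2 := mu) _ m3 f3.
have f2 := fubini_F_ge0 _ _ _ _ mu _ f3.
apply: (etrans (fubini_tonelli1 (m1 := prob3) (m2 := mu) f mf f0)).
apply: (etrans (fubini_tonelli1 (m1 := prob2) (m2 := mu) _ m3 f3)).
by apply: (etrans (fubini_tonelli1 (m1 := mu) (m2 := mu) _ m2 f2)).
Qed.

Definition pr4 g : R := fine (prob4 (quad_set g)).

Lemma prob4E g : measurable4 g -> prob4 (quad_set g) = (pr4 g)%:E.
Proof.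
by move=> mg; rewrite /pr4 fineK// fin_num_measure//; exact: measurable_quad_set.
Qed.

Lemma integral_prob4 g : measurable4 g -> (\int[prob4]_z f4 g z = (pr4 g)%:E)%E.
Proof.
move=> /[dup] mg /measurable_quad_set mg'.
by rewrite f4E integral_indic ?setIT//; exact: prob4E.
Qed.

Lemma integral4_prob4 g : measurable4 g ->
  integral4 (fun a b c d => ((g a b c d)%:R)%:E) = (pr4 g)%:E.
Proof.
by move=> mg; rewrite -integral_prob4// integral_quad//; exact: measurable_f4.
Qed.

(** By Tonelli in the two innermost variables. Together with the swap of the second and third
    samples this gives every permutation that fixes the first sample. *)
Lemma pr4_swap34 g : measurable4 g ->
  measurable4 (fun a b c d => g a b d c) -> pr4 (fun a b c d => g a b d c) = pr4 g.
Proof.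
move=> mg mg'; apply: EFin_inj.
rewrite -(integral4_prob4 _ mg) -(integral4_prob4 _ mg').
apply: eq_integral => a _; apply: eq_integral => b _.
have mf : measurable_fun setT (fun z : T * T => f4 g (a, b, z.1, z.2)).
  apply: (measurableT_comp (measurable_f4 g mg)).
  by apply: measurable_fun_pair => //; apply: measurable_fun_pair.
exact: (esym (fubini_tonelli (m1 := mu) (m2 := mu) _ mf (fun z => f4_ge0 g _))).
Qed.

Lemma pr4_swap23 g : measurable4 g ->
  measurable4 (fun a b c d => g a c b d) -> pr4 (fun a b c d => g a c b d) = pr4 g.
Proof.
move=> mg mg'; apply: EFin_inj.
rewrite -(integral4_prob4 _ mg) -(integral4_prob4 _ mg').
apply: eq_integral => a _.
have mf : measurable_fun setT (fun z : T * T * T => f4 g (a, z.1.1, z.1.2, z.2)).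
  apply: (measurableT_comp (measurable_f4 g mg)).
  apply: measurable_fun_pair => //; apply: measurable_fun_pair => //.
    apply: measurable_fun_pair => //.
    exact: (measurableT_comp measurable_fst measurable_fst).
  exact: (measurableT_comp measurable_snd measurable_fst).
have f0 (z : T * T * T) : (0 <= f4 g (a, z.1.1, z.1.2, z.2))%E by exact: f4_ge0.
(* The innermost integral over [d] is formed first, as a measurable function of the two variables to
   be exchanged. *)
have m3 := measurable_fun_fubini_tonelli_F (m2 := mu) _ mf f0.
exact: (esym (fubini_tonelli (m1 := mu) (m2 := mu) _ m3 (fubini_F_ge0 _ _ _ _ mu _ f0))).
Qed.

(** Integration carries a pointwise counting inequality over to probabilities. The weights are
    natural numbers and sit on both sides, so only nonnegative functions are integrated. *)
Lemma pr4_weighted_le (L L' : seq (nat * (T -> T -> T -> T -> bool))) :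
  List.Forall (fun p => measurable4 p.2) L ->
  List.Forall (fun p => measurable4 p.2) L' ->
  (forall a b c d, \sum_(p <- L) p.1 * p.2 a b c d <=
                   \sum_(p <- L') p.1 * p.2 a b c d)%N ->
  \sum_(p <- L) p.1%:R * pr4 p.2 <= \sum_(p <- L') p.1%:R * pr4 p.2.
Proof.
move=> mL mL' le.
pose F (L : seq (nat * (T -> T -> T -> T -> bool))) (z : quad) :=
  (\sum_(p <- L) (p.1%:R%:E * f4 p.2 z))%E.
have F0 L0 z : (0 <= F L0 z)%E.
  by apply: sume_ge0 => p _; apply: mule_ge0; rewrite ?lee_fin.
have intF L0 : List.Forall (fun p => measurable4 p.2) L0 ->
    measurable_fun setT (F L0) /\
    (\int[prob4]_z F L0 z = (\sum_(p <- L0) p.1%:R * pr4 p.2)%:E)%E.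
  elim: L0 => [_|p L0 IH mL0].
    rewrite (_ : F [::] = cst 0%E); last by apply/funext => z; rewrite /F big_nil.
    by split; [exact: measurable_cst | rewrite integral0 big_nil].
  have [mF IF] := IH (List.Forall_inv_tail mL0).
  have mp : measurable4 p.2 := List.Forall_inv mL0.
  have mZ : measurable_fun setT (fun z => p.1%:R%:E * f4 p.2 z)%E.
    by apply: measurable_funeM; exact: measurable_f4.
  rewrite (_ : F (p :: L0) = (fun z => p.1%:R%:E * f4 p.2 z + F L0 z)%E); last first.
    by apply/funext => z; rewrite /F big_cons.
  split; first exact: emeasurable_funD.
  rewrite ge0_integralD//; last by move=> z _; apply: mule_ge0; rewrite ?lee_fin.
  rewrite IF ge0_integralZl_EFin//; last exact: measurable_f4.
  by rewrite integral_prob4// big_cons EFinD EFinM.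
have [mF IF] := intF L mL; have [mF' IF'] := intF L' mL'.
rewrite -lee_fin -IF -IF'; apply: ge0_le_integral => // z _.
have FE L0 : F L0 z =
    ((\sum_(p <- L0) p.1 * p.2 z.1.1.1 z.1.1.2 z.1.2 z.2)%N%:R)%:E.
  rewrite natr_sum -sumEFin; apply: eq_bigr => p _.
  by rewrite natrM EFinM.
by rewrite !FE lee_fin ler_nat.
Qed.

End four_samples.

Ltac measurable4_solve := rewrite /measurable4; cbv beta; repeat
  match goal with
  | |- measurable_fun _ (fun _ => _ && _) => apply: measurable_and
  | |- measurable_fun _ (fun _ => _ == _) => apply: measurable_circle_eq
  | |- measurable_fun _ (fun _ => chords_meet _ _ _ _ _) =>
      apply: measurable_chords_meet
  | |- measurable_fun _ (fun z => z.1.1.1) => exact: measurable_coord1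
  | |- measurable_fun _ (fun z => z.1.1.2) => exact: measurable_coord2
  | |- measurable_fun _ (fun z => z.1.2) => exact: measurable_coord3
  | |- measurable_fun _ (fun z => z.2) => exact: measurable_coord4
  end.

(** * Coincidence probabilities as power sums of the atoms *)

Section moments.
Context (R : realType) (mu : probability (circle R) R).
Local Notation T := (circle R).

Definition mass (a : T) : R := fine (mu [set a]).

Lemma measurable_circle1 (a : T) : measurable [set a].
Proof.
have h : measurable_fun setT (fun y : T => y == a).
  by apply: measurable_circle_eq; [exact: measurable_id | exact: measurable_cst].
have := h measurableT [set true] I; rewrite setTI.
by congr (measurable _); apply/seteqP; split => x /= /eqP.
Qed.

Lemma massE a : mu [set a] = (mass a)%:E.
Proof. by rewrite /mass fineK// fin_num_measure//; exact: measurable_circle1. Qed.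

Lemma mass_ge0 a : 0 <= mass a.
Proof. exact: fine_ge0. Qed.

Lemma indic_circle1 (a y : T) : \1_[set a] y = (a == y)%:R :> R.
Proof.
rewrite indicE; congr (nat_of_bool _)%:R.
by apply/idP/eqP => [/set_mem ->//|->]; apply/mem_set.
Qed.

(** The integrand is the constant [h a] times the indicator of the point [a]. *)
Lemma integral_pick (a : T) (h : T -> R) : 0 <= h a ->
  (\int[mu]_y ((a == y)%:R * h y)%:E = (mass a * h a)%:E)%E.
Proof.
move=> ha.
under eq_integral => y _.
  rewrite (_ : (a == y)%:R * h y = h a * \1_[set a] y); last first.
    by rewrite indic_circle1; case: (eqVneq a y) => [->|_]; rewrite ?mul0r ?mulr0 1?mulrC.
  rewrite EFinM; over.
rewrite ge0_integralZl_EFin//; last first.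
  by apply/measurable_EFinP; apply: measurable_indic; exact: measurable_circle1.
rewrite integral_indic//; last exact: measurable_circle1.
rewrite setIT [mass a * _]mulrC EFinM; congr (_ * _)%E; exact: massE.
Qed.

Lemma integral_real_cst (k : R) : (\int[mu]_y k%:E = k%:E)%E.
Proof. rewrite integral_cst// -[RHS]mule1; congr (_ * _)%E; exact: probability_setT. Qed.

Context n (x : 'I_n -> T) (alpha : 'I_n -> R).
Hypothesis x_inj : injective x.
Hypothesis alpha_ge0 : forall i, 0 <= alpha i.
Hypothesis mass_atoms : forall a, mass a = \sum_(i < n) alpha i * (x i == a)%:R.

Definition power_sum k : R := \sum_(i < n) alpha i ^+ k.

Lemma mass_atom i : mass (x i) = alpha i.
Proof.
rewrite mass_atoms (bigD1 i)//= eqxx mulr1 big1 ?addr0// => j ji.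
by rewrite (inj_eq x_inj) (negbTE ji) mulr0.
Qed.

(** The atoms are distinct, so at most one term is nonzero and powers pass through the sum. The
    exponent is positive because away from the atoms the power must be 0. *)
Lemma mass_exp k a : mass a ^+ k.+1 = \sum_(i < n) (x i == a)%:R * alpha i ^+ k.+1.
Proof.
have [[i <-]|na] := pselect (exists i, x i = a).
  rewrite mass_atom (bigD1 i)//= eqxx mul1r big1 ?addr0// => j ji.
  by rewrite (inj_eq x_inj) (negbTE ji) mul0r.
have xa i : (x i == a) = false by apply/eqP => xia; apply: na; exists i.
rewrite mass_atoms !big1 ?expr0n//= => i _; rewrite xa ?mul0r ?mulr0//.
Qed.

Lemma measurable_mass : measurable_fun setT mass.
Proof.
rewrite (_ : mass = fun a => \sum_(i < n) alpha i * \1_[set x i] a); last first.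
  apply/funext => a; rewrite mass_atoms; apply: eq_bigr => i _.
  by rewrite indic_circle1.
apply: measurable_sum => i; apply: measurable_funM; first exact: measurable_cst.
by apply: measurable_indic; exact: measurable_circle1.
Qed.

(** Integrating the indicator of [x i] contributes one more factor [alpha i], which raises the
    exponent by one. *)
Lemma integral_mass_exp k :
  (\int[mu]_a (mass a ^+ k.+1)%:E = (power_sum k.+2)%:E)%E.
Proof.
under eq_integral => a _ do rewrite mass_exp -sumEFin.
rewrite ge0_integral_sum//; last 2 first.
- move=> i; apply/measurable_EFinP; apply: measurable_funM; last exact: measurable_cst.
  rewrite (_ : (fun a => _) = \1_[set x i]).
    by apply: measurable_indic; exact: measurable_circle1.
  by apply/funext => a; rewrite indic_circle1.
- by move=> i a _; rewrite lee_fin mulr_ge0// exprn_ge0.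
rewrite /power_sum -sumEFin; apply: eq_bigr => i _.
by rewrite (integral_pick _ (cst (alpha i ^+ k.+1))) ?exprn_ge0// mass_atom -exprS.
Qed.


Let natr_andb (p q : bool) : (p && q)%:R = p%:R * q%:R :> R.
Proof. by rewrite -mulnb natrM. Qed.

Lemma pr4_from_integral g (s : R) : measurable4 R g ->
  (integral4 R mu (fun a b c d => ((g a b c d)%:R)%:E) = s%:E)%E -> pr4 R mu g = s.
Proof. by move=> mg gs; apply: EFin_inj; rewrite -(integral4_prob4 _ _ _ mg). Qed.

Lemma pr4_true : pr4 R mu (fun _ _ _ _ => true) = 1.
Proof.
apply: pr4_from_integral; first exact: measurable_cst.
rewrite -[RHS]integral_real_cst; apply: eq_integral => a _.
rewrite -[RHS]integral_real_cst; apply: eq_integral => b _.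
by rewrite integral_real_cst integral_real_cst.
Qed.

Lemma integral_pick_eq (a : T) (f : T -> R) (h : T -> R) : 0 <= h a ->
  (forall y, f y = (a == y)%:R * h y) -> (\int[mu]_y (f y)%:E = (mass a * h a)%:E)%E.
Proof.
by move=> ha fE; rewrite -integral_pick//; apply: eq_integral => y _; rewrite fE.
Qed.

(** As in the computations below, the innermost variables are integrated first: an unconstrained one
    gives 1, and one tied to an earlier variable gives the mass of that point. *)
Lemma pr4_eq12 : pr4 R mu (fun a b _ _ => a == b) = power_sum 2.
Proof.
apply: pr4_from_integral; first by measurable4_solve.
rewrite -(integral_mass_exp 0); apply: eq_integral => a _.
transitivity (\int[mu]_b ((a == b)%:R * 1)%:E)%E.
  by apply: eq_integral => b _; rewrite mulr1 !integral_real_cst.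
by rewrite (integral_pick _ (cst 1))// mulr1 expr1.
Qed.

(** The available swaps fix the first sample, so pairs that avoid it need a starting case of their
    own. *)
Lemma pr4_eq34 : pr4 R mu (fun _ _ c d => c == d) = power_sum 2.
Proof.
apply: pr4_from_integral; first by measurable4_solve.
rewrite -integral_real_cst; apply: eq_integral => a _.
rewrite -integral_real_cst; apply: eq_integral => b _.
rewrite -(integral_mass_exp 0); apply: eq_integral => c _.
by rewrite (integral_pick_eq c _ (cst 1))// ?mulr1// => y; rewrite mulr1.
Qed.

Lemma pr4_eq12_34 : pr4 R mu (fun a b c d => (a == b) && (c == d)) = power_sum 2 ^+ 2.
Proof.
apply: pr4_from_integral; first by measurable4_solve.
have S0 : 0 <= power_sum 2 by apply: sumr_ge0 => i _; rewrite exprn_ge0.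
transitivity (\int[mu]_a \int[mu]_b ((a == b)%:R * power_sum 2)%:E)%E.
  apply: eq_integral => a _; apply: eq_integral => b _.
  rewrite EFinM -(integral_mass_exp 0) -ge0_integralZl_EFin//; last 2 first.
  - by move=> c _; rewrite lee_fin exprn_ge0// mass_ge0.
  - by apply/measurable_EFinP; apply: measurable_funX; exact: measurable_mass.
  apply: eq_integral => c _; rewrite -EFinM expr1 mulrC.
  by rewrite (integral_pick_eq c _ (cst (a == b)%:R))// => d; rewrite natr_andb mulrC.
transitivity (\int[mu]_a ((power_sum 2)%:E * (mass a ^+ 1)%:E))%E.
  by apply: eq_integral => a _; rewrite (integral_pick _ (cst (power_sum 2)))// -EFinM mulrC.
rewrite ge0_integralZl_EFin//; last 2 first.
- by move=> c _; rewrite lee_fin exprn_ge0// mass_ge0.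
- by apply/measurable_EFinP; apply: measurable_funX; exact: measurable_mass.
by rewrite integral_mass_exp -EFinM.
Qed.

Lemma pr4_eq123 : pr4 R mu (fun a b c _ => (a == b) && (b == c)) = power_sum 3.
Proof.
apply: pr4_from_integral; first by measurable4_solve.
rewrite -(integral_mass_exp 1); apply: eq_integral => a _.
transitivity (\int[mu]_b ((a == b)%:R * mass b)%:E)%E; last first.
  by rewrite (integral_pick _ mass) ?mass_ge0.
apply: eq_integral => b _; rewrite mulrC.
rewrite -(integral_pick_eq b (fun c => ((a == b) && (b == c))%:R) (cst (a == b)%:R))//.
  by apply: eq_integral => c _; rewrite integral_real_cst.
by move=> c; rewrite natr_andb mulrC.
Qed.

Lemma pr4_eq234 : pr4 R mu (fun _ b c d => (b == c) && (c == d)) = power_sum 3.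
Proof.
apply: pr4_from_integral; first by measurable4_solve.
rewrite -integral_real_cst; apply: eq_integral => a _.
rewrite -(integral_mass_exp 1).
apply: eq_integral => b _.
transitivity (\int[mu]_c ((b == c)%:R * mass c)%:E)%E; last first.
  by rewrite (integral_pick _ mass) ?mass_ge0.
apply: eq_integral => c _; rewrite mulrC.
by rewrite (integral_pick_eq c _ (cst (b == c)%:R))// => d; rewrite natr_andb mulrC.
Qed.

Lemma pr4_eq1234 :
  pr4 R mu (fun a b c d => [&& a == b, b == c & c == d]) = power_sum 4.
Proof.
apply: pr4_from_integral; first by measurable4_solve.
rewrite -(integral_mass_exp 2); apply: eq_integral => a _.
transitivity (\int[mu]_b ((a == b)%:R * mass b ^+ 2)%:E)%E; last first.
  by rewrite (integral_pick _ (fun b => mass b ^+ 2)) ?exprn_ge0 ?mass_ge0// -exprS.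
apply: eq_integral => b _.
rewrite (_ : (a == b)%:R * mass b ^+ 2 = mass b * ((a == b)%:R * mass b)); last by ring.
rewrite -(integral_pick b (fun c => (a == b)%:R * mass c)) ?mulr_ge0 ?mass_ge0//.
apply: eq_integral => c _.
rewrite (integral_pick_eq c _ (cst ((a == b) && (b == c))%:R))//; last first.
  by move=> d; rewrite andbA natr_andb mulrC.
by rewrite /= natr_andb; congr (_%:E); ring.
Qed.

End moments.

(** * The elementary inequality between power sums *)

Lemma power_sums_bound (R : realType) n (alpha : 'I_n -> R) :
  (forall i, 0 <= alpha i) -> \sum_(i < n) alpha i <= 1 ->
  power_sum R n alpha 2 / 6 <= 6 * power_sum R n alpha 2
    + 12 * power_sum R n alpha 4 - 9 * power_sum R n alpha 2 ^+ 2
    - 8 * power_sum R n alpha 3.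
Proof.
move=> a0 a1.
(* 12 t^2 - 8 t + 4 / 3 = 12 (t - 1 / 3)^2 *)
have term t : - (4 / 3) * t ^+ 2 <= 12 * t ^+ 4 - 8 * t ^+ 3 :> R.
  have : 0 <= t ^+ 2 * (t - 1 / 3) ^+ 2 by rewrite mulr_ge0 ?sqr_ge0.
  rewrite (_ : _ * _ = t ^+ 4 - 2 / 3 * t ^+ 3 + 1 / 9 * t ^+ 2); last by field.
  by lra.
have sum_term (P : pred 'I_n) :
    - (4 / 3) * \sum_(i < n | P i) alpha i ^+ 2 <=
    12 * \sum_(i < n | P i) alpha i ^+ 4 - 8 * \sum_(i < n | P i) alpha i ^+ 3.
  by rewrite !mulr_sumr -sumrB; apply: ler_sum.
have S0 : 0 <= power_sum R n alpha 2 by apply: sumr_ge0 => i _; rewrite exprn_ge0.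
have [S2|S2] := leP (power_sum R n alpha 2) (1 / 2).
  (* Here [9 * S2 ^ 2 <= 9 / 2 * S2], and [6 - 4 / 3 - 9 / 2 = 1 / 6] is the constant of the
     statement. *)
  have := sum_term xpredT; rewrite -!/(power_sum _ _ _ _) => h.
  by nra.
(* Otherwise some atom has mass 1 / 2 + t. The other atoms have total mass at
   most 1 / 2 - t, and the worst case is a single atom of that mass. *)
have [i Mi] : exists i, 1 / 2 < alpha i.
  apply: contrapT => /forallNP h; move: S2; apply/negP; rewrite -leNgt.
  apply: (@le_trans _ _ (\sum_(i < n) 1 / 2 * alpha i)).
    apply: ler_sum => i _; rewrite expr2 ler_wpM2r//.
    by rewrite leNgt; apply/negP; exact: h.
  by rewrite -mulr_sumr; lra.
have := sum_term (fun j => j != i).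
move: S2 a1; rewrite /power_sum !(bigD1 i (P := xpredT))//=.
set r1 := \sum_(j < n | j != i) alpha j.
set r2 := \sum_(j < n | j != i) alpha j ^+ 2.
set r3 := \sum_(j < n | j != i) alpha j ^+ 3.
set r4 := \sum_(j < n | j != i) alpha j ^+ 4.
move=> S2 a1 h.
have r1_ge0 : 0 <= r1 by apply: sumr_ge0.
have r2_ge0 : 0 <= r2 by apply: sumr_ge0 => j _; rewrite exprn_ge0.
have r2r1 : r2 <= r1 ^+ 2.
  rewrite expr2 mulr_sumr; apply: ler_sum => j ji; rewrite expr2 ler_wpM2r//.
  by rewrite /r1 (bigD1 j)//= lerDl sumr_ge0.
move: Mi S2 a1 h r2_ge0 r2r1; clearbody r1 r2 r3 r4.
have [t ->] : exists t, alpha i = 1 / 2 + t by exists (alpha i - 1 / 2); ring.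
move=> Mi S2 a1 h r2_ge0 r2r1.
have t0 : 0 <= t by lra.
have t1 : t <= 1 / 2 by lra.
have r2t : r2 <= (1 / 2 - t) ^+ 2.
  by apply: le_trans r2r1 _; rewrite ler_sqr ?nnegrE; lra.
(* At [r2], [f] bounds from below the difference of the two sides: [35 / 6] is [6 - 1 / 6], and
   [4 / 3 * r] pays for the cubes and fourth powers of the other atoms. *)
pose f r := 35 / 6 * ((1 / 2 + t) ^+ 2 + r) - 4 / 3 * r + 12 * (1 / 2 + t) ^+ 4
  - 8 * (1 / 2 + t) ^+ 3 - 9 * ((1 / 2 + t) ^+ 2 + r) ^+ 2.
suff : 0 <= f r2 by rewrite /f; lra.
(* The second factor is nonnegative because [18 * (1 / 2 + t) ^ 2 >= 9 / 2]; so [f] is smallest at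
   the largest possible [r2]. *)
have : f ((1 / 2 - t) ^+ 2) <= f r2.
  rewrite -subr_ge0 (_ : _ - _ = ((1 / 2 - t) ^+ 2 - r2) *
    (18 * (1 / 2 + t) ^+ 2 + 9 * (1 / 2 - t) ^+ 2 + 9 * r2 - 9 / 2)); last by rewrite /f; field.
  apply: mulr_ge0; first lra.
  by rewrite !expr2; nra.
apply: le_trans.
rewrite (_ : f _ = 1 / 12 + 4 / 3 * t - 5 / 3 * t ^+ 2 + 16 * t ^+ 3 - 24 * t ^+ 4);
  last by rewrite /f; field.
(* For [0 <= t <= 1 / 2] the linear term absorbs the quadratic one, and the cubic term the quartic
   one. *)
have e1 : t ^+ 2 <= 1 / 2 * t by rewrite expr2; nra.
have t3 : 0 <= t ^+ 3 by rewrite exprn_ge0.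
have e2 : t ^+ 4 <= 1 / 2 * t ^+ 3 by rewrite exprS; nra.
by lra.
Qed.

(** * Integrating the counting inequality over four samples *)

Section crossing_probability.
Context (R : realType) (mu : probability (circle R) R).
Context (n : nat) (x : 'I_n -> circle R) (alpha : 'I_n -> R).
Hypothesis x_inj : injective x.
Hypothesis alpha_ge0 : forall i, 0 <= alpha i.
Hypothesis mass_atoms : forall a, mass R mu a = \sum_(i < n) alpha i * (x i == a)%:R.
Local Notation S := (power_sum R n alpha).

Lemma pr4_chords_meet_bound :
  3 * pr4 R mu (chords_meet R) + 6 * S 2 + 12 * S 4 <= 1 + 9 * S 2 ^+ 2 + 8 * S 3.
Proof.
pose meet2 a b c d := chords_meet R a c b d.
pose meet3 a b c d := chords_meet R a d b c.
have m1 : measurable4 R (chords_meet R) by measurable4_solve.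
have m2 : measurable4 R meet2 by rewrite /meet2; measurable4_solve.
have m3 : measurable4 R meet3 by rewrite /meet3; measurable4_solve.
have M2 : pr4 R mu meet2 = pr4 R mu (chords_meet R) by exact: (pr4_swap23 R mu (chords_meet R) m1 m2).
have M3 : pr4 R mu meet3 = pr4 R mu meet2 by exact: (pr4_swap34 R mu meet2 m2 m3).
pose e12 (a b c d : circle R) := a == b.
pose e13 (a b c d : circle R) := a == c.
pose e14 (a b c d : circle R) := a == d.
pose e23 (a b c d : circle R) := b == c.
pose e24 (a b c d : circle R) := b == d.
pose e34 (a b c d : circle R) := c == d.
have me12 : measurable4 R e12 by rewrite /e12; measurable4_solve.
have me13 : measurable4 R e13 by rewrite /e13; measurable4_solve.
have me14 : measurable4 R e14 by rewrite /e14; measurable4_solve.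
have me23 : measurable4 R e23 by rewrite /e23; measurable4_solve.
have me24 : measurable4 R e24 by rewrite /e24; measurable4_solve.
have me34 : measurable4 R e34 by rewrite /e34; measurable4_solve.
(* Swaps lead from 12 to 13 to 14 and from 34 to 24 to 23; pairs of pairs and triples are reached in
   the same way. *)
have E12 : pr4 R mu e12 = S 2 by exact: (pr4_eq12 R mu n x alpha).
have E13 : pr4 R mu e13 = S 2 by exact: (etrans (pr4_swap23 R mu e12 me12 _) E12).
have E14 : pr4 R mu e14 = S 2 by exact: (etrans (pr4_swap34 R mu e13 me13 _) E13).
have E34 : pr4 R mu e34 = S 2 by exact: (pr4_eq34 R mu n x alpha).
have E24 : pr4 R mu e24 = S 2 by exact: (etrans (pr4_swap23 R mu e34 me34 _) E34).
have E23 : pr4 R mu e23 = S 2 by exact: (etrans (pr4_swap34 R mu e24 me24 _) E24).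
pose p12 (a b c d : circle R) := (a == b) && (c == d).
pose p13 (a b c d : circle R) := (a == c) && (b == d).
pose p14 (a b c d : circle R) := (a == d) && (b == c).
have mp12 : measurable4 R p12 by rewrite /p12; measurable4_solve.
have mp13 : measurable4 R p13 by rewrite /p13; measurable4_solve.
have mp14 : measurable4 R p14 by rewrite /p14; measurable4_solve.
have P12 : pr4 R mu p12 = S 2 ^+ 2 by exact: (pr4_eq12_34 R mu n x alpha).
have P13 : pr4 R mu p13 = S 2 ^+ 2 by exact: (etrans (pr4_swap23 R mu p12 mp12 _) P12).
have P14 : pr4 R mu p14 = S 2 ^+ 2 by exact: (etrans (pr4_swap34 R mu p13 mp13 _) P13).
pose t123 (a b c d : circle R) := (a == b) && (b == c).
pose t124 (a b c d : circle R) := (a == b) && (b == d).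
pose t134 (a b c d : circle R) := (a == c) && (c == d).
pose t234 (a b c d : circle R) := (b == c) && (c == d).
have mt123 : measurable4 R t123 by rewrite /t123; measurable4_solve.
have mt124 : measurable4 R t124 by rewrite /t124; measurable4_solve.
have mt134 : measurable4 R t134 by rewrite /t134; measurable4_solve.
have mt234 : measurable4 R t234 by rewrite /t234; measurable4_solve.
have T123 : pr4 R mu t123 = S 3 by exact: (pr4_eq123 R mu n x alpha).
have T124 : pr4 R mu t124 = S 3 by exact: (etrans (pr4_swap34 R mu t123 mt123 _) T123).
have T134 : pr4 R mu t134 = S 3 by exact: (etrans (pr4_swap23 R mu t124 mt124 _) T124).
have T234 : pr4 R mu t234 = S 3 by exact: (pr4_eq234 R mu n x alpha).
pose q (a b c d : circle R) := [&& a == b, b == c & c == d].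
have mq : measurable4 R q by rewrite /q; measurable4_solve.
have Q : pr4 R mu q = S 4 by exact: (pr4_eq1234 R mu n x alpha).
pose tt (a b c d : circle R) := true.
have mtt : measurable4 R tt by exact: measurable_cst.
have TT : pr4 R mu tt = 1 by exact: (pr4_true R mu).
pose L := [:: (1, chords_meet R); (1, meet2); (1, meet3); (1, e12); (1, e13);
  (1, e14); (1, e23); (1, e24); (1, e34); (12, q)]%N.
pose L' := [:: (1, tt); (3, p12); (3, p13); (3, p14);
  (2, t123); (2, t124); (2, t134); (2, t234)]%N.
have mL : List.Forall (fun p => measurable4 R p.2) L.
  apply: List.Forall_cons; first exact: m1.
  apply: List.Forall_cons; first exact: m2.
  apply: List.Forall_cons; first exact: m3.
  apply: List.Forall_cons; first exact: me12.
  apply: List.Forall_cons; first exact: me13.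
  apply: List.Forall_cons; first exact: me14.
  apply: List.Forall_cons; first exact: me23.
  apply: List.Forall_cons; first exact: me24.
  apply: List.Forall_cons; first exact: me34.
  apply: List.Forall_cons; first exact: mq.
  exact: List.Forall_nil.
have mL' : List.Forall (fun p => measurable4 R p.2) L'.
  apply: List.Forall_cons; first exact: mtt.
  apply: List.Forall_cons; first exact: mp12.
  apply: List.Forall_cons; first exact: mp13.
  apply: List.Forall_cons; first exact: mp14.
  apply: List.Forall_cons; first exact: mt123.
  apply: List.Forall_cons; first exact: mt124.
  apply: List.Forall_cons; first exact: mt134.
  apply: List.Forall_cons; first exact: mt234.
  exact: List.Forall_nil.
have leL a b c d :
    (\sum_(p <- L) p.1 * p.2 a b c d <= \sum_(p <- L') p.1 * p.2 a b c d)%N.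
  have := chords_meet_bound R a b c d; rewrite /L /L' !big_cons !big_nil.
  rewrite /tt /p12 /p13 /p14 /t123 /t124 /t134 /t234 /q /e12 /e13 /e14 /e23 /e24 /e34.
  rewrite /meet2 /meet3 /fst /snd.
  by lia.
have := pr4_weighted_le R mu L L' mL mL' leL; rewrite /L /L' !big_cons !big_nil /fst /snd.
clear mL mL' leL L L' m1 m2 m3 me12 me13 me14 me23 me24 me34 mp12 mp13 mp14.
clear mt123 mt124 mt134 mt234 mq mtt.
clearbody meet2 meet3 e12 e13 e14 e23 e24 e34 p12 p13 p14 t123 t124 t134 t234 q tt.
rewrite M3 M2 E12 E13 E14 E23 E24 E34 P12 P13 P14 T123 T124 T134 T234 Q TT.
move: (pr4 _ _ _) (S 2) (S 3) (S 4) => p s2 s3 s4 h.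
clear M2 M3 E12 E13 E14 E23 E24 E34 P12 P13 P14 T123 T124 T134 T234 Q TT.
by lra.
Qed.

End crossing_probability.

(** * Deduction of the bounds on the atoms *)

Theorem proposition2p8 (R : realType) (C : R) (hC : 0 < C) :
  exists2 C' : R, 0 < C' &
    forall (n : nat) (x : 'I_n -> circle R) (alpha : 'I_n -> R)
      (mu_c : {measure set (circle R) -> \bar R})
      (mu : probability (circle R) R) (delta : R),
      (1 <= n)%N ->
      injective x ->
      (forall i, 0 < alpha i) ->
      (forall p : circle R, mu_c [set p] = 0%E) ->
      (0 < mu_c [set: circle R] < 1)%E ->
      (forall A : set (circle R), measurable A ->
        mu A = (\sum_(i < n) (alpha i)%:E * \d_(x i) A + mu_c A)%E) ->
      0 < delta ->
      ((1 / 3 - C * delta ^+ 2)%:E <= prob_ell_lt mu 1)%E ->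
      (\esum_(p in [set p : circle R | mu [set p] != 0%E]) (mu [set p] ^+ 2)%E
         <= (C' * delta ^+ 2)%:E)%E /\
      (forall p : circle R, (mu [set p] <= (Num.sqrt C' * delta)%:E)%E).
Proof.
(* The hypothesis gives [1 - 3 * C * delta ^ 2 <= 3 * P], while [3 * P <= 1 - S2 / 6]; hence
   [S2 <= 18 * C * delta ^ 2]. *)
exists (18 * C); first by lra.
move=> n x alpha mu_c mu delta _ x_inj alpha_gt0 mu_c_diffuse _ muE delta_gt0 hP.
have alpha_ge0 i : 0 <= alpha i by exact: ltW.
have mass_atoms a : mass R mu a = \sum_(i < n) alpha i * (x i == a)%:R.
  apply: EFin_inj; rewrite -massE muE; last exact: measurable_circle1.
  rewrite mu_c_diffuse adde0 -sumEFin; apply: eq_bigr => i _.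
  by rewrite diracE EFinM eq_sym -indic_circle1 indicE.
have alpha_le1 : \sum_(i < n) alpha i <= 1.
  rewrite -lee_fin -(probability_setT mu) muE// -sumEFin.
  rewrite (eq_bigr (fun i => (alpha i)%:E * \d_(x i) [set: circle R]))%E.
    by rewrite leeDl.
  by move=> i _; rewrite diracT mule1.
have prE : prob_ell_lt mu 1 = (pr4 R mu (chords_meet R))%:E.
  rewrite -prob4E; last by measurable4_solve.
  congr (prob4 R mu _); apply/funext => z; rewrite /quad_set /=.
  by rewrite ell_lt1.
have S2 : power_sum R n alpha 2 <= 18 * C * delta ^+ 2.
  move: hP; rewrite prE lee_fin => hP.
  have := pr4_chords_meet_bound R mu n x alpha x_inj alpha_ge0 mass_atoms.
  have := power_sums_bound R n alpha alpha_ge0 alpha_le1.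
  by lra.
have sq_mass p : mass R mu p ^+ 2 <= 18 * C * delta ^+ 2.
  rewrite (mass_exp R mu n x alpha x_inj mass_atoms 1); apply: le_trans S2.
  apply: ler_sum => i _; rewrite -[leRHS]mul1r ler_wpM2r ?exprn_ge0//.
  by case: eqVneq.
split; last first.
  move=> p; rewrite massE lee_fin -(ger0_norm (mass_ge0 R mu p)) -sqrtr_sqr.
  rewrite -[delta]ger0_norm ?(ltW delta_gt0)// -sqrtr_sqr -sqrtrM; last by lra.
  by rewrite ler_wsqrtr.
(* Since [mu_c] is diffuse and each [alpha i] is positive, the points of nonzero mass are exactly
   the [x i]. Listing them without repetition turns the sum over the circle into the finite sum
   [S2]. *)
pose r := [seq x i | i <- enum 'I_n].
have rE : [set p | mu [set p] != 0%E] = [set` r].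
  apply/seteqP; split => p /=; rewrite massE eqe.
    apply: contraR => /mapP np; rewrite mass_atoms big1// => i _.
    case: eqVneq => [xi|_]; last by rewrite mulr0.
    by case: np; exists i; rewrite ?mem_enum.
  move=> /mapP[i _ ->].
  by rewrite (mass_atom R mu n x alpha x_inj mass_atoms) gt_eqF.
have r_uniq : uniq r by rewrite map_inj_uniq ?enum_uniq.
rewrite rE esum_fset//; last 2 first.
- exact: finite_seq.
- by move=> p _; rewrite massE -EFin_expe lee_fin sqr_ge0.
rewrite -fsbig_seq// big_map big_enum/=.
rewrite (eq_bigr (fun i => (alpha i ^+ 2)%:E)); last first.
  by move=> i _; rewrite EFin_expe massE (mass_atom R mu n x alpha x_inj mass_atoms).
by rewrite sumEFin lee_fin.
Qed.
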